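(* For every $\epsilon\in(\sqrt3-1,2]$, the subdivision scheme $S_\epsilon$ is uniformly convergent: for every $f^0\in\ell_\infty(\mathbb{Z})$, with $f^{k+1}=S_\epsilon f^k$ for $k\ge0$, there exists a continuous function $S_\epsilon^\infty f^0:\mathbb{R}\to\mathbb{R}$ such that $$\lim_{k\to\infty}\sup_{i\in\mathbb{Z}}\left|f^k_i-(S_\epsilon^\infty f^0)(i2^{-k})\right|=0.$$
   Context: $\ell_\infty(\mathbb{Z})$ is the space of bounded real sequences indexed by $\mathbb{Z}$. For $\epsilon>0$, define $\Gamma_\epsilon:\mathbb{R}^4\to\mathbb{R}$ by $$\Gamma_\epsilon(f_{-1},f_0,f_1,f_2)=\begin{cases}\dfrac12\,\dfrac{1}{\left(1+\sqrt{1+\frac{f_2-f_{-1}}{f_1-f_0}}\right)^2-1}, & f_1\ne f_0 \text{ and } 1+\frac{f_2-f_{-1}}{f_1-f_0}\ge \epsilon^2,\\[4pt] 0, & f_{-1}\le f_0=f_1\le f_2 \text{ or } f_{-1}\ge f_0=f_1\ge f_2,\\[2pt] \frac1{16}, & \text{otherwise.}\end{cases}$$ The scheme $S_\epsilon:\ell_\infty(\mathbb{Z})\to\ell_\infty(\mathbb{Z})$ is given by $$(S_\epsilon f)_{2i}=f_i,\qquad (S_\epsilon f)_{2i+1}=\tfrac12 f_i+\tfrac12 f_{i+1}-\Gamma_\epsilon(f_{i-1},f_i,f_{i+1},f_{i+2})\,(f_{i+2}-f_{i+1}-f_i+f_{i-1}).$$ *)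

(* Defs.v *)
From mathcomp Require Import all_boot all_order all_algebra.
From mathcomp Require Import all_classical all_reals all_analysis.
From mathcomp Require Import lra.

Set Implicit Arguments.
Unset Strict Implicit.
Unset Printing Implicit Defensive.

Import Order.TTheory GRing.Theory Num.Theory.
Import numFieldNormedType.Exports.

Local Open Scope classical_set_scope.
Local Open Scope ring_scope.

Definition ell_infty (R : realType) : set (int -> R) := bounded_fun.

(* The arguments a, b, c, d stand for f_{-1}, f_0, f_1, f_2. *)
Definition Gamma (R : realType) (eps a b c d : R) : R :=
  if (c != b) && (eps ^+ 2 <= 1 + (d - a) / (c - b)) then
    2^-1 * (1 / ((1 + Num.sqrt (1 + (d - a) / (c - b))) ^+ 2 - 1))
  else if [&& a <= b, b == c & c <= d] || [&& b <= a, b == c & d <= c] then 0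
  else 1 / 16.

(* Integer division is floor division, so that an odd n is 2i + 1 with
   i = (n %/ 2)%Z also when n < 0: see [subdivE] and [subdivO]. *)
Definition subdiv (R : realType) (eps : R) (f : int -> R) (n : int) : R :=
  let i := (n %/ 2)%Z in
  if (2 %| n)%Z then f i
  else 2^-1 * f i + 2^-1 * f (i + 1)
       - Gamma eps (f (i - 1)) (f i) (f (i + 1)) (f (i + 2))
         * (f (i + 2) - f (i + 1) - f i + f (i - 1)).

Lemma subdivE (R : realType) (eps : R) (f : int -> R) (i : int) :
  subdiv eps f (2 * i) = f i.
Proof. by rewrite /subdiv dvdz_mulr // mulKz. Qed.

Lemma subdivO (R : realType) (eps : R) (f : int -> R) (i : int) :
  subdiv eps f (2 * i + 1) =
  2^-1 * f i + 2^-1 * f (i + 1)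
  - Gamma eps (f (i - 1)) (f i) (f (i + 1)) (f (i + 2))
    * (f (i + 2) - f (i + 1) - f i + f (i - 1)).
Proof.
have odd_n : (2 %| 2 * i + 1)%Z = false.
  by rewrite (sameP dvdz_mod0P eqP) (mulrC 2) modzMDl.
by rewrite /subdiv odd_n (mulrC 2) divzMDl // addr0.
Qed.

Lemma Gamma_bounded (R : realType) (eps a b c d : R) :
  0 < eps -> `|Gamma eps a b c d| <= eps^-1 + 1.
Proof.
move=> eps0; have ie0 : 0 < eps^-1 by rewrite invr_gt0.
rewrite /Gamma; case: ifPn => [/andP[_ h]|_]; last first.
  case: ifPn => _; first by rewrite normr0 addr_ge0// ltW.
  by rewrite ger0_norm//; lra.
set t := Num.sqrt _.
have et : eps <= t.
  by rewrite -(ger0_norm (ltW eps0)) -sqrtr_sqr ler_wsqrtr.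
have den : eps <= (1 + t) ^+ 2 - 1 by nra.
have den0 : 0 < (1 + t) ^+ 2 - 1 by exact: lt_le_trans den.
have iden : ((1 + t) ^+ 2 - 1)^-1 <= eps^-1 by rewrite lef_pV2.
have iden0 : 0 < ((1 + t) ^+ 2 - 1)^-1 by rewrite invr_gt0.
by rewrite div1r ger0_norm; lra.
Qed.

Lemma subdiv_ell_infty (R : realType) (eps : R) (f : int -> R) :
  0 < eps -> ell_infty f -> ell_infty (subdiv eps f).
Proof.
move=> eps0; have PF : ProperFilter (globally [set: int]).
  exact: (globally_properfilter (a := 0)).
move=> /ex_bound[M fM]; apply/ex_bound.
have {}fM i : `|f i| <= M by exact: fM.
have M0 : 0 <= M := le_trans (normr_ge0 _) (fM 0).
exists (M + (eps^-1 + 1) * (M *+ 4)) => n _ /=; rewrite /subdiv.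
set i := (n %/ 2)%Z; have ie0 : 0 < eps^-1 by rewrite invr_gt0.
have MG0 : 0 <= (eps^-1 + 1) * (M *+ 4).
  by apply: mulr_ge0; rewrite ?mulrn_wge0// addr_ge0// ltW.
case: ifPn => _; first by rewrite (le_trans (fM i))// lerDl.
apply: (le_trans (ler_normB _ _)); apply: lerD.
  move: (fM i) (fM (i + 1)); rewrite !ler_norml => /andP[? ?] /andP[? ?].
  by apply/andP; split; lra.
rewrite normrM ler_pM ?Gamma_bounded//.
move: (fM i) (fM (i + 1)) (fM (i + 2)) (fM (i - 1)); rewrite !ler_norml.
move=> /andP[? ?] /andP[? ?] /andP[? ?] /andP[? ?].
by apply/andP; split; rewrite -mulr_natr; lra.
Qed.

(* The supremum is taken in the extended reals: the real-valued [sup] of an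
   unbounded set is 0 by convention, which would make the limit vacuous. *)
Definition uniformly_convergent (R : realType)
    (S : (int -> R) -> (int -> R)) : Prop :=
  forall f0 : int -> R, ell_infty f0 ->
  exists2 Finf : R -> R, continuous Finf &
    (fun k : nat => ereal_sup
       (range (fun i : int =>
          (`| iter k S f0 i - Finf (i%:~R * 2 ^- k) |)%:E)))
    @ \oo --> 0%E.

(* Main.v *)
(* Splitting a first difference [d_i] produces the two differences
   [d_i / 2 -+ Gamma * (d_{i+1} - d_{i-1})], and, when [eps <= 2],
   [|Gamma| <= 1 / (2 ((1 + eps)^2 - 1))]; hence one step multiplies the sup
   norm of the first differences by at most [1/2 + 1 / ((1 + eps)^2 - 1)],
   which is below 1 exactly when [eps > sqrt 3 - 1].  The step functions
   [x |-> f^k (floor (2^k x))] then converge uniformly at a geometric rate;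
   their jumps tend to 0, so the limit is continuous, and since the scheme is
   interpolatory the limit agrees with [f^k] on the grid of mesh [2^-k]. *)
Require Import Defs.
From mathcomp Require Import all_boot all_order all_algebra.
From mathcomp Require Import all_classical all_reals all_analysis.
From mathcomp Require Import zify ring lra.

Import Order.TTheory GRing.Theory Num.Theory.
Import numFieldNormedType.Exports.

Local Open Scope classical_set_scope.
Local Open Scope ring_scope.

Lemma int_parity (n : int) : exists j : int, n = 2 * j \/ n = 2 * j + 1.
Proof. by exists (n %/ 2)%Z; lia. Qed.

(** Passing from level [k] to [k.+1] doubles the argument of the floor; this locates the new grid
    index relative to the doubled old one. *)
Lemma floor_double (R : realType) (x : R) :
  Num.floor (2 * x) = 2 * Num.floor x \/
  Num.floor (2 * x) = 2 * Num.floor x + 1.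
Proof.
have /andP[lex ltx] := floor_itv x.
have /andP[le2x lt2x] := floor_itv (2 * x).
have : (2 * Num.floor x)%:~R < (Num.floor (2 * x) + 1)%:~R :> R.
  by rewrite (le_lt_trans _ lt2x)// intrM ler_pM2l.
have : (Num.floor (2 * x))%:~R < (2 * (Num.floor x + 1))%:~R :> R.
  by rewrite (le_lt_trans le2x)// intrM ltr_pM2l.
by rewrite !ltr_int; lia.
Qed.

Lemma floor_adjacent (R : realType) (x y : R) : `|x - y| < 1 ->
  [\/ Num.floor x = Num.floor y, Num.floor x = Num.floor y + 1
    | Num.floor y = Num.floor x + 1].
Proof.
rewrite ltr_norml => /andP[ltyx ltxy].
have /andP[lex ltx] := floor_itv x; have /andP[ley lty] := floor_itv y.
have : (Num.floor x)%:~R < (Num.floor y + 1 + 1)%:~R :> R.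
  by move: lex lty; rewrite !intrD; lra.
have : (Num.floor y)%:~R < (Num.floor x + 1 + 1)%:~R :> R.
  by move: ley ltx; rewrite !intrD; lra.
rewrite !ltr_int => h1 h2.
have [->|[->|->]] : Num.floor x = Num.floor y \/
  (Num.floor x = Num.floor y + 1 \/ Num.floor y = Num.floor x + 1) by lia.
- exact: Or31.
- exact: Or32.
- exact: Or33.
Qed.

(** With [K = D / (1 - c)], each increment bound [D * c ^+ k] equals [K * c ^+ k - K * c ^+ k.+1],
    so the bounds telescope. The tail estimate gives the Cauchy property and passes to the limit. *)
Lemma geometric_cvg (R : realType) (D c : R) (u : nat -> R) :
  0 <= D -> 0 <= c < 1 ->
  (forall k, `|u k.+1 - u k| <= D * c ^+ k) ->
  cvgn u /\ forall k, `|limn u - u k| <= D / (1 - c) * c ^+ k.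
Proof.
move=> D0 /andP[c0 c1] uD; set K := D / (1 - c).
have K0 : 0 <= K by rewrite divr_ge0// subr_ge0 ltW.
have KD : D = K * (1 - c) by rewrite mulfVK//; lra.
have tail k m : `|u (k + m)%N - u k| <= K * c ^+ k - K * c ^+ (k + m).
  elim: m => [|m IHm]; first by rewrite addn0 !subrr normr0.
  rewrite addnS -(subrKA (u (k + m)%N)) (le_trans (ler_normD _ _))//.
  have := uD (k + m)%N; rewrite KD exprS; lra.
have tailW k n : (k <= n)%N -> `|u n - u k| <= K * c ^+ k.
  move=> /subnKC <-; apply: le_trans (tail _ _) _.
  by rewrite gerBl mulr_ge0// exprn_ge0.
have Kc0 : (fun k => K * c ^+ k) @ \oo --> (0 : R).
  rewrite -[X in _ --> X](mulr0 K); apply: cvgMr; apply: cvg_expr.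
  by rewrite ger0_norm.
have cvu : cvgn u.
  apply/cauchy_cvgP/cauchy_exP => e e0.
  have /cvgr0Pnorm_lt/(_ e e0)[N _ Ne] := Kc0.
  exists (u N); exists N => // n /= Nn.
  rewrite /ball /= distrC (le_lt_trans (tailW _ _ Nn))//.
  by rewrite (le_lt_trans (ler_norm _))// Ne /=.
split=> // k; have cvk : (fun n => `|u n - u k|) @ \oo --> `|limn u - u k|.
  by apply: cvg_norm; apply: cvgB => //; exact: cvg_cst.
rewrite -(cvg_lim _ cvk)//; apply: limr_le.
  by apply/cvg_ex; eexists; exact: cvk.
by exists k => // n /= kn; exact: tailW.
Qed.

Lemma Gamma_le (R : realType) (eps a b c d : R) : 0 < eps <= 2 ->
  `|Gamma eps a b c d| <= 2^-1 * ((1 + eps) ^+ 2 - 1)^-1.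
Proof.
move=> /andP[eps0 eps2]; have den0 : 0 < (1 + eps) ^+ 2 - 1 by nra.
rewrite /Gamma; case: ifPn => [/andP[_ h]|_]; last first.
  case: ifPn => _; first by rewrite normr0 mulr_ge0// invr_ge0 ltW.
  (* Here [eps <= 2] enters: it gives [(1 + eps) ^+ 2 - 1 <= 8], so the default value 1/16 obeys the
     bound. *)
  have : 8^-1 <= ((1 + eps) ^+ 2 - 1)^-1 by rewrite lef_pV2// ?posrE//; nra.
  by rewrite ger0_norm; lra.
set t := Num.sqrt _.
have et : eps <= t.
  by rewrite -(ger0_norm (ltW eps0)) -sqrtr_sqr ler_wsqrtr.
have dent : (1 + eps) ^+ 2 - 1 <= (1 + t) ^+ 2 - 1 by nra.
have dent0 := lt_le_trans den0 dent.
rewrite div1r ger0_norm; last by rewrite mulr_ge0// invr_ge0 ltW.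
by rewrite ler_pM2l// lef_pV2.
Qed.

Definition contraction_factor (R : realType) (eps : R) : R :=
  2^-1 + ((1 + eps) ^+ 2 - 1)^-1.

Lemma contraction_factor_itv (R : realType) (eps : R) :
  Num.sqrt 3 - 1 < eps -> 0 <= contraction_factor R eps < 1.
Proof.
move=> heps; have s0 := sqrtr_ge0 (3 : R).
have s3 : Num.sqrt 3 ^+ 2 = 3 :> R by rewrite sqr_sqrtr.
have den : 2 < (1 + eps) ^+ 2 - 1 by nra.
have den0 : 0 < (1 + eps) ^+ 2 - 1 by lra.
have : ((1 + eps) ^+ 2 - 1)^-1 < 2^-1 by rewrite ltf_pV2// posrE.
have : 0 < ((1 + eps) ^+ 2 - 1)^-1 by rewrite invr_gt0.
by rewrite /contraction_factor => h1 h2; apply/andP; split; lra.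
Qed.

Lemma subdiv_diff (R : realType) (eps D : R) (f : int -> R) :
  0 < eps <= 2 -> (forall i, `|f (i + 1) - f i| <= D) ->
  forall n, `|subdiv eps f (n + 1) - subdiv eps f n|
            <= contraction_factor R eps * D.
Proof.
move=> heps fD n; have [i nE] := int_parity n.
pose G := Gamma eps (f (i - 1)) (f i) (f (i + 1)) (f (i + 2)).
pose w := f (i + 2) - f (i + 1) - f i + f (i - 1).
have Gw : `|G * w| <= ((1 + eps) ^+ 2 - 1)^-1 * D.
  have wD : `|w| <= 2 * D.
    (* Regrouped as the right neighbouring first difference minus the left one, each at most [D]. *)
    have -> : w = (f (i + 1 + 1) - f (i + 1)) - (f (i - 1 + 1) - f (i - 1)).
      by rewrite subrK (_ : i + 1 + 1 = i + 2) /w; [ring | lia].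
    rewrite (le_trans (ler_normB _ _))//.
    by rewrite mulrDl mul1r lerD.
  rewrite normrM (le_trans (ler_pM _ _ (Gamma_le _ _ _ _ _ _ heps) wD))//.
  by rewrite mulrACA mulVf// mul1r.
have := fD i; move: Gw; rewrite /contraction_factor mulrDl.
set K := _^-1 * D; case: nE => ->; last first.
  have -> : 2 * i + 1 + 1 = 2 * (i + 1) by lia.
  rewrite subdivE subdivO -/G -/w !ler_norml => /andP[? ?] /andP[? ?].
  by apply/andP; split; lra.
rewrite subdivE subdivO -/G -/w !ler_norml => /andP[? ?] /andP[? ?].
by apply/andP; split; lra.
Qed.

Lemma iter_subdiv_diff (R : realType) (eps D : R) (f : int -> R) :
  0 < eps <= 2 -> (forall i, `|f (i + 1) - f i| <= D) ->
  forall k i, `|iter k (subdiv eps) f (i + 1) - iter k (subdiv eps) f i|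
              <= D * contraction_factor R eps ^+ k.
Proof.
move=> heps fD; elim=> [|k IHk] i /=; first by rewrite mulr1.
by rewrite exprS mulrCA; exact: subdiv_diff.
Qed.

Lemma iter_subdiv_dyadic (R : realType) (eps : R) (f : int -> R) k m (i : int) :
  iter (m + k) (subdiv eps) f (2 ^+ m * i) = iter k (subdiv eps) f i.
Proof.
by elim: m => [|m IHm]; rewrite ?mul1r// addSn iterS exprS -mulrA subdivE.
Qed.

Theorem theorem13 (R : realType) (eps : R)
    (heps_gt : Num.sqrt 3 - 1 < eps) (heps_le : eps <= 2) :
  uniformly_convergent (subdiv eps).
Proof.
move=> f0 f0_bounded.
have heps : 0 < eps <= 2.
  rewrite heps_le andbT (le_lt_trans _ heps_gt)// subr_ge0.
  by rewrite -[leLHS]sqrtr1 ler_wsqrtr// ler1n.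
have PF : ProperFilter (globally [set: int]).
  exact: (globally_properfilter (a := 0)).
have [M {}f0_bounded] : exists M : R, forall i, `|f0 i| <= M.
  by move: f0_bounded => /ex_bound[M fM]; exists M => i; exact: fM.
pose D := M + M; set c := contraction_factor R eps.
have /andP[c0 c1] : 0 <= c < 1 := contraction_factor_itv _ _ heps_gt.
have D0 : 0 <= D by rewrite addr_ge0// (le_trans _ (f0_bounded 0)).
have f0D i : `|f0 (i + 1) - f0 i| <= D.
  by rewrite (le_trans (ler_normB _ _))// lerD.
pose fk k := iter k (subdiv eps) f0.
have fkD k i : `|fk k (i + 1) - fk k i| <= D * c ^+ k.
  exact: iter_subdiv_diff.
have Dc0 k : 0 <= D * c ^+ k by rewrite mulr_ge0// exprn_ge0.
(* The level-[k] step function evaluated at [x]; its pointwise limit in [k] is the limit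
   function. *)
pose u (x : R) k := fk k (Num.floor (2 ^+ k * x)).
have uD x k : `|u x k.+1 - u x k| <= D * c ^+ k.
  (* Interpolation lifts the old value to level [k.+1], where the two indices are equal or
     adjacent. *)
  have -> : u x k = fk k.+1 (2 * Num.floor (2 ^+ k * x)).
    by rewrite /fk iterS subdivE.
  rewrite /u exprS -mulrA; have [->|->] := floor_double _ (2 ^+ k * x).
    by rewrite subrr normr0.
  apply: le_trans (fkD _ _) _.
  by rewrite ler_wpM2l// exprS ler_piMl ?exprn_ge0// ltW.
have c01 : 0 <= c < 1 by rewrite c0.
have ucvg x := geometric_cvg _ _ _ (u x) D0 c01 (uD x).
exists (fun x => limn (u x)); last first.
  have grid k i : limn (u (i%:~R * 2 ^- k)) = fk k i.
    (* At a grid point of level [k], the sequence is constant from index [k] on. *)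
    apply: cvg_lim => //; rewrite -(cvg_shiftn k); apply: cvg_near_cst.
    apply: nearW => m /=; rewrite /u exprD mulrCA -mulrA mulfV ?expf_neq0//.
    have -> : i%:~R * (2 ^+ m * 1) = (2 ^+ m * i)%:~R :> R.
      by rewrite intrM rmorphXn/= mulr1 mulrC.
    by rewrite intrKfloor /fk iter_subdiv_dyadic.
  apply: cvg_near_cst; apply: nearW => k /=.
  (* All errors vanish, so every supremum is 0, not merely small. Both inclusions matter: the
     supremum of the empty set would be [-oo]. *)
  set A := (X in ereal_sup X); suff -> : A = [set 0%E] by rewrite ereal_sup1.
  apply/seteqP; split=> [_ [i _ <-]|_ ->] /=; last exists 0 => //.
    by rewrite grid subrr normr0.
  by rewrite grid subrr normr0.
move=> x; apply/cvgrPdist_lt => e e0.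
set K := D / (1 - c) in ucvg.
(* The sum [K + D + K] collects the distance from the limit to level [k] at [x], one jump of the
   step function, and the same distance at [y]. *)
have Kc0 : (fun k => (K + D + K) * c ^+ k) @ \oo --> (0 : R).
  rewrite -[X in _ --> X](mulr0 (K + D + K)); apply: cvgMr; apply: cvg_expr.
  by rewrite ger0_norm.
have /cvgr0Pnorm_lt/(_ e e0)[k _ /(_ k (leqnn k)) ke] := Kc0.
have p0 : 0 < 2 ^- k :> R by rewrite invr_gt0 exprn_gt0.
near=> y.
(* The level [k] depends on [e] only; within one mesh width of [x], the cells of [x] and [y]
   coincide or are adjacent. *)
have ltxy : `|x - y| < 2 ^- k.
  by near: y; apply/nbhs_ballP; exists (2 ^- k).
have xy : `|2 ^+ k * x - 2 ^+ k * y| < 1.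
  have p1 : 0 < 2 ^+ k :> R by rewrite exprn_gt0.
  by rewrite -mulrBr normrM gtr0_norm// mulrC -ltr_pdivlMr// div1r.
have uxy : `|u x k - u y k| <= D * c ^+ k.
  rewrite /u; have [->|->|->] := floor_adjacent _ _ _ xy; last rewrite distrC.
  - by rewrite subrr normr0.
  - exact: fkD.
  - exact: fkD.
have [_ /(_ k) ux] := ucvg x; have [_ /(_ k) uy] := ucvg y.
rewrite (le_lt_trans _ ke)// (le_trans _ (ler_norm _))//.
move: ux uy uxy; rewrite !mulrDl !ler_norml.
by move=> /andP[? ?] /andP[? ?] /andP[? ?]; apply/andP; split; lra.
Unshelve. all: by end_near.
Qed.
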